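(* Let $m,n\in\mathbb{N}$ (natural numbers, including $0$) and suppose $m\ge1$ or $n\le1$. Then the rule $\mathrm{Ros}^\Box$ is admissible in $\mathbf{N}\mathbf{A}_{m,n}$; that is, for every formula $\varphi$, if $\mathbf{N}\mathbf{A}_{m,n}\vdash\neg\Box\varphi$, then $\mathbf{N}\mathbf{A}_{m,n}\vdash\neg\Box\Box\varphi$. Consequently, $\mathbf{N}^+\mathbf{A}_{m,n}=\mathbf{N}\mathbf{A}_{m,n}$ (as sets of theorems).
   Context: Language: modal formulae are built from propositional variables, the constant $\bot$, $\neg$, $\lor$, and $\Box$; $\varphi\to\psi$ abbreviates $\neg\varphi\lor\psi$. $\Box^0\varphi=\varphi$ and $\Box^{k+1}\varphi=\Box\Box^k\varphi$. Logics: $\mathbf{N}$ has as axioms all propositional tautologies in the modal language and as rules modus ponens and necessitation (from $\varphi$ infer $\Box\varphi$). $\mathbf{N}\mathbf{A}_{m,n}$ is $\mathbf{N}$ plus the axiom scheme $\Box^n\varphi\to\Box^m\varphi$ (all formulae $\varphi$). $\mathbf{N}^+\mathbf{A}_{m,n}$ is $\mathbf{N}\mathbf{A}_{m,n}$ plus the rule $\mathrm{Ros}^\Box$: from $\neg\Box\varphi$ infer $\neg\Box\Box\varphi$. *)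

(* Defs.v *)
From Stdlib Require Import Bool Arith.

Inductive form : Set :=
| Var (p : nat)
| Bot
| Neg (A : form)
| Or (A B : form)
| Box (A : form).

Definition Imp (A B : form) : form := Or (Neg A) B.

Fixpoint box_iter (k : nat) (A : form) : form :=
  match k with
  | 0 => A
  | S k => Box (box_iter k A)
  end.

(* A boxed formula is treated as an atom: [v] gives the value of propositional
   variables and of boxed formulae, and is not consulted elsewhere. *)
Fixpoint prop_eval (v : form -> bool) (A : form) : bool :=
  match A with
  | Var _ | Box _ => v A
  | Bot => false
  | Neg B => negb (prop_eval v B)
  | Or B C => prop_eval v B || prop_eval v C
  end.

Definition tautology (A : form) : Prop :=
  forall v : form -> bool, prop_eval v A = true.

(* [rule A B] reads: from the premise [A] infer [B]. *)
Definition rule := form -> form -> Prop.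

(* The logic N extended by the axioms [Ax] and the one-premise rule [R]. *)
Inductive N_ext (Ax : form -> Prop) (R : rule) : form -> Prop :=
| N_taut A : tautology A -> N_ext Ax R A
| N_ax A : Ax A -> N_ext Ax R A
| N_mp A B : N_ext Ax R (Imp A B) -> N_ext Ax R A -> N_ext Ax R B
| N_nec A : N_ext Ax R A -> N_ext Ax R (Box A)
| N_rule A B : R A B -> N_ext Ax R A -> N_ext Ax R B.

Inductive AccAx (m n : nat) : form -> Prop :=
| AccAx_intro A : AccAx m n (Imp (box_iter n A) (box_iter m A)).

Inductive RosBox : rule :=
| RosBox_intro A : RosBox (Neg (Box A)) (Neg (Box (Box A))).

Definition no_rule : rule := fun _ _ => False.

Definition NA (m n : nat) : form -> Prop := N_ext (AccAx m n) no_rule.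

Definition NplusA (m n : nat) : form -> Prop := N_ext (AccAx m n) RosBox.

Definition admissible (R : rule) (L : form -> Prop) : Prop :=
  forall A B : form, R A B -> L A -> L B.

(* Main.v *)
From Stdlib Require Import Bool Lia.
Require Import Defs.

(** If [1 <= m] or [m = n = 0], then making every boxed formula true satisfies
    every theorem of NA, so no formula [Neg (Box A)] is provable and the rule is
    vacuously admissible.  In the remaining case [m = 0], [n = 1], the axiom
    [Imp (Box (Box A)) (Box A)] turns a proof of [Neg (Box A)] into a proof of
    [Neg (Box (Box A))] by contraposition. *)

Lemma NA_true_of_all_boxes_true (m n : nat) (hmn : 1 <= m \/ n = m) (A : form) :
  NA m n A -> prop_eval (fun _ => true) A = true.
Proof.
  intros H.
  induction H as [A HA | A HA | A B _ IHAB _ IHA | A _ _ | A B [] _ _].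
  - apply HA.
  - destruct HA as [A]; simpl.
    (* For [1 <= m] the consequent is itself boxed, hence true; for [n = m] the axiom has the form
       [Imp B B]. *)
    destruct hmn as [hm | ->].
    + destruct m as [|m]; [lia | apply orb_true_r].
    + apply orb_negb_l.
  - simpl in IHAB; rewrite IHA in IHAB; exact IHAB.
  - reflexivity.
Qed.

Lemma N_ext_contrapose (Ax : form -> Prop) (R : rule) (A B : form) :
  N_ext Ax R (Imp A B) -> N_ext Ax R (Neg B) -> N_ext Ax R (Neg A).
Proof.
  intros HAB HB.
  apply N_mp with (Neg B); [|exact HB].
  apply N_mp with (Imp A B); [|exact HAB].
  apply N_taut; intros v; simpl.
  destruct (prop_eval v A), (prop_eval v B); reflexivity.
Qed.

Lemma RosBox_admissible (m n : nat) (hmn : 1 <= m \/ n <= 1) :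
  admissible RosBox (NA m n).
Proof.
  intros _ _ [A] HA.
  assert (Hcases : (1 <= m \/ n = m) \/ (m = 0 /\ n = 1)) by lia.
  destruct Hcases as [Hvac | [-> ->]].
  (* The valuation makes [Neg (Box A)] false, so [HA] is contradictory. *)
  - discriminate (NA_true_of_all_boxes_true m n Hvac _ HA).
  - apply N_ext_contrapose with (Box A); [|exact HA].
    apply N_ax, (AccAx_intro 0 1 (Box A)).
Qed.

(** Uses of [R] can be eliminated from the top of a derivation downwards: by induction the premise
    already has an [R]-free proof, to which admissibility applies. *)
Lemma N_ext_admissible_rule (Ax : form -> Prop) (R : rule) :
  admissible R (N_ext Ax no_rule) ->
  forall A : form, N_ext Ax R A <-> N_ext Ax no_rule A.
Proof.
  intros Hadm A; split; intros H.
  - induction H as [A HA | A HA | A B _ IHAB _ IHA | A _ IHA | A B HR _ IHA].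
    + now apply N_taut.
    + now apply N_ax.
    + now apply N_mp with A.
    + now apply N_nec.
    + exact (Hadm A B HR IHA).
  - induction H as [A HA | A HA | A B _ IHAB _ IHA | A _ IHA | A B [] _ _].
    + now apply N_taut.
    + now apply N_ax.
    + now apply N_mp with A.
    + now apply N_nec.
Qed.

Theorem proposition4p2 (m n : nat) (hmn : 1 <= m \/ n <= 1) :
  admissible RosBox (NA m n) /\
  (forall A : form, NplusA m n A <-> NA m n A).
Proof.
  split.
  - exact (RosBox_admissible m n hmn).
  - exact (N_ext_admissible_rule _ _ (RosBox_admissible m n hmn)).
Qed.
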